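(* Let $0\le\alpha<1$ and let $f=(f_n)_{n\ge 0}$ be a scalar-valued $L^2$-martingale relative to $(\mathcal{F}_n)_{n\ge 0}$. The following statements are equivalent: (I) $f\in BMO^\alpha$; (II) the measure $|d_kf|^2\,dP\otimes dm$ on $\Omega\times\mathbb{N}$ is a bounded $\alpha$-Carleson measure, i.e. $$\sup_\tau \frac{1}{P(\tau<\infty)^{1+2\alpha}}\int_{\widehat{\tau}}|d_kf|^2\,dP\otimes dm<\infty,$$ where the supremum runs over all stopping times $\tau$.
   Context: $(\Omega,\mathcal{F},P)$ is a complete probability space and $(\mathcal{F}_n)_{n\ge 0}$ is an increasing sequence of sub-$\sigma$-fields of $\mathcal{F}$ with $\mathcal{F}=\bigvee_n\mathcal{F}_n$. For a martingale $f=(f_n)_{n\ge0}$ write $d_nf=f_n-f_{n-1}$, with the convention $f_{-1}=0$. All martingales are assumed to be finite (there is $N$ with $d_nf=0$ for all $n>N$), and a martingale is identified with its final value, also denoted $f$ ($=f_\infty$). For $0\le\alpha\le1$, an $L^2$-martingale $f$ belongs to $BMO^\alpha$ if $$\|f\|_{BMO^\alpha}:=\sup_{n\ge0}\ \sup_{A\in\mathcal{F}_n}P(A)^{-1/2-\alpha}\Big(\int_A|f-f_{n-1}|^2\,dP\Big)^{1/2}<\infty,$$ the inner supremum being over $A\in\mathcal{F}_n$ with $P(A)>0$. $\mathbb{N}=\{0,1,2,\dots\}$ and $dm$ is the counting measure on $\mathbb{N}$. Stopping times are relative to $(\mathcal{F}_n)$ and take values in $\{0,1,2,\dots\}\cup\{\infty\}$.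 The tent over a stopping time $\tau$ is $\widehat{\tau}=\{(\omega,k)\in\Omega\times\mathbb{N}: k\ge\tau(\omega),\ \tau(\omega)<\infty\}$. For $0\le\alpha<1$, a nonnegative measure $\mu$ on $\Omega\times\mathbb{N}$ is a bounded $\alpha$-Carleson measure if $\sup_\tau \mu(\widehat{\tau})/P(\tau<\infty)^{1+2\alpha}<\infty$, the supremum being over all stopping times $\tau$ (with $P(\tau<\infty)>0$). *)

(* Defs.v *)
From HB Require Import structures.
From mathcomp Require Export all_boot all_order all_algebra.
From mathcomp Require Export all_classical all_reals all_analysis.
From mathcomp.real_closed Require Export complex.

Set Implicit Arguments.
Unset Strict Implicit.
Unset Printing Implicit Defensive.

Export Order.TTheory GRing.Theory Num.Theory.
Export numFieldNormedType.Exports.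
Export ComplexField.Normc.

Local Open Scope classical_set_scope.
Local Open Scope ring_scope.

(* Scalars are complex numbers R[i]; a real-valued martingale is the case of
   vanishing imaginary part, for which every quantity below is unchanged.
   Sub-sigma-fields are sets of subsets of Omega. *)

Section Martingales.
Context {d : measure_display} {Omega : measurableType d} {R : realType}.
Variable P : probability Omega R.

Definition increasing_sigma_fields (F : nat -> set (set Omega)) : Prop :=
  [/\ forall n, sigma_algebra setT (F n),
      forall n, F n `<=` measurable &
      forall n, F n `<=` F n.+1].

(* measurability for the two coordinates is Borel measurability into R[i] *)
Definition cmeasurable (G : set (set Omega)) (X : Omega -> R[i]) : Prop :=
  forall B : set R, measurable B ->
    G [set w | B (complex.Re (X w))] /\ G [set w | B (complex.Im (X w))].

Definition cintegrable (X : Omega -> R[i]) : Prop :=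
  P.-integrable setT (fun w => (complex.Re (X w))%:E) /\
  P.-integrable setT (fun w => (complex.Im (X w))%:E).

Definition cintegral (A : set Omega) (X : Omega -> R[i]) : R[i] :=
  Complex (\int[P]_(w in A) complex.Re (X w))
          (\int[P]_(w in A) complex.Im (X w)).

(* Y is a version of E[X | G] *)
Definition is_cond_exp (G : set (set Omega)) (X Y : Omega -> R[i]) : Prop :=
  [/\ cmeasurable G Y, cintegrable Y &
      forall A, G A -> cintegral A Y = cintegral A X].

Definition martingale (F : nat -> set (set Omega))
    (f : nat -> Omega -> R[i]) : Prop :=
  [/\ forall n, cmeasurable (F n) (f n),
      forall n, cintegrable (f n) &
      forall n, is_cond_exp (F n) (f n.+1) (f n)].

Definition L2_bounded (f : nat -> Omega -> R[i]) : Prop :=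
  (ereal_sup [set \int[P]_w ((normc (f n w)) ^+ 2)%:E | n in [set: nat]]
     < +oo)%E.

(* f_{n-1}, with f_{-1} = 0 *)
Definition prev (f : nat -> Omega -> R[i]) (n : nat) : Omega -> R[i] :=
  if n is m.+1 then f m else fun=> 0.

Definition mdiff (f : nat -> Omega -> R[i]) (n : nat) : Omega -> R[i] :=
  fun w => f n w - prev f n w.

(* the martingale stops at time N, so that its final value is f N *)
Definition finite_at (f : nat -> Omega -> R[i]) (N : nat) : Prop :=
  forall n, (N < n)%N -> {ae P, forall w, mdiff f n w = 0}.

(* f is the martingale and g its final value *)
Definition BMO_norm (F : nat -> set (set Omega)) (alpha : R)
    (f : nat -> Omega -> R[i]) (g : Omega -> R[i]) : \bar R :=
  ereal_sup [set
    ereal_sup [set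
      (P A `^ (- 2^-1 - alpha) *
       (\int[P]_(w in A) ((normc (g w - prev f n w)) ^+ 2)%:E) `^ (2^-1))%E
      | A in [set A | F n A /\ (0 < P A)%E]]
    | n in [set: nat]].

Definition in_BMO (F : nat -> set (set Omega)) (alpha : R)
    (f : nat -> Omega -> R[i]) (g : Omega -> R[i]) : Prop :=
  (BMO_norm F alpha f g < +oo)%E.

(* None is the value infinity *)
Definition stopping_time (F : nat -> set (set Omega))
    (tau : Omega -> option nat) : Prop :=
  forall n, F n [set w | exists2 t, tau w = Some t & (t <= n)%N].

Definition event_finite (tau : Omega -> option nat) : set Omega :=
  [set w | tau w <> None].

Definition tent (tau : Omega -> option nat) : set (Omega * nat) :=
  [set z | exists2 t, tau z.1 = Some t & (t <= z.2)%N].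

Definition bounded_Carleson (F : nat -> set (set Omega)) (alpha : R)
    (mu : set (Omega * nat) -> \bar R) : Prop :=
  (ereal_sup [set mu (tent tau) / (P (event_finite tau) `^ (1 + 2 * alpha))
    | tau in [set tau | stopping_time F tau /\ 0 < P (event_finite tau)]]
    < +oo)%E.

(* the measure |d_k f|^2 dP (x) dm *)
Definition square_diff_measure (f : nat -> Omega -> R[i])
    (E : set (Omega * nat)) : \bar R :=
  (\int[P \x @counting nat R]_(z in E)
     ((normc (mdiff f z.2 z.1)) ^+ 2)%:E)%E.

End Martingales.

(* Main.v *)
From HB Require Import structures.
Require Import Defs.
From mathcomp Require Import measurable_realfun ring lra.

(** Martingale increments are orthogonal in L^2, even after localization to a
    set [A] of [F_n]: the integral of [|f - f_{n-1}|^2] over [A] is the sum over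
    [k >= n] of the integrals of [|d_k f|^2] over [A].  Slicing the tent over
    [tau] into the events [{tau = n}] therefore gives
    [mu(tent tau) = sum_n \int_{tau = n} |f - f_{n-1}|^2].  The BMO bounds on
    the slices sum up because [P(tau = n)^(2 alpha) <= P(tau < oo)^(2 alpha)];
    conversely, [tau := n] on [A] and [oo] elsewhere turns the Carleson bound
    into the BMO bound for [A]. *)

Local Open Scope classical_set_scope.
Local Open Scope ring_scope.

(** * Functions with zero conditional expectation and [G]-measurable factors *)

Section pull_out.
Context {d : measure_display} {Omega : measurableType d} {R : realType}.
Variables (P : {measure set Omega -> \bar R}) (G : set (set Omega)).
Hypotheses (sG : sigma_algebra setT G) (Gm : G `<=` measurable).

Lemma sub_measurable_fun (X : Omega -> R) :
  (forall B, measurable B -> G (X @^-1` B)) -> measurable_fun setT X.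
Proof. by move=> GX _ B mB; rewrite setTI; apply/Gm/GX. Qed.

(** Retyping the domain as [g_sigma_algebraType G] makes the general lemmas on measurable functions
    available relative to [G]; [sigma_sub_measurable_fun] brings their conclusions back to preimages
    lying in [G]. *)
Lemma sub_measurable_fun_sigma (X : Omega -> R) :
  (forall B, measurable B -> G (X @^-1` B)) ->
  measurable_fun setT (X : g_sigma_algebraType G -> R).
Proof.
by move=> GX _ B mB; rewrite setTI measurable_g_measurableTypeE//; exact: GX.
Qed.

Lemma sigma_sub_measurable_fun (X : Omega -> R) :
  measurable_fun setT (X : g_sigma_algebraType G -> R) ->
  forall B, measurable B -> G (X @^-1` B).
Proof.
move=> mX B mB; have := mX measurableT B mB.
by rewrite setTI measurable_g_measurableTypeE.
Qed.

Variable D : Omega -> R.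
Hypotheses (mD : measurable_fun setT D)
  (iD : P.-integrable setT (EFin \o D))
  (D0 : forall A, G A -> (\int[P]_(w in A) (D w)%:E = 0)%E).

Import HBNNSimple.

Let integral_nnsfunM (h : {nnsfun g_sigma_algebraType G >-> R}) :
  (\int[P]_w (h w * D w)%:E = 0)%E.
Proof.
have hG r : G (h @^-1` [set r]).
  by apply: sigma_sub_measurable_fun => //; exact: measurable_set1.
under eq_integral do rewrite fimfunEord mulr_suml -sumEFin.
rewrite integral_sum//=; last first.
  move=> i; under eq_fun do rewrite -mulrA EFinM.
  apply: integrableZl => //.
  apply: (le_integrable _ _ _ iD) => //.
    apply/measurable_EFinP/measurable_funM => //.
    by apply: measurable_indic; exact: Gm.
  move=> w _ /=; rewrite lee_fin normrM indicE.
  by case: (_ \in _); rewrite ?normr1 ?mul1r// normr0 mul0r.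
rewrite big1// => i _.
under eq_integral do rewrite -mulrA EFinM.
set r := _`_i.
transitivity (r%:E * \int[P]_(w in h @^-1` [set r]) (D w)%:E)%E; last first.
  by rewrite D0 ?mule0.
rewrite [in RHS]integral_mkcond -integralZl//; last first.
  apply/(integrable_mkcond _ _).1 => //; first exact: Gm.
  by apply: integrableS iD => //; exact: Gm.
apply: eq_integral => w _; rewrite patchE indicE.
by case: ifPn => _; rewrite ?mul1r ?mul0r.
Qed.

(* Approximating [X] by simple functions for the sigma-algebra [G] itself keeps
   every level set in [G], where [D] integrates to 0. *)
Let integral_subM_ge0 (X : Omega -> R) :
  (forall B, measurable B -> G (X @^-1` B)) -> (forall w, 0 <= X w) ->
  P.-integrable setT (fun w => (X w * D w)%:E) ->
  (\int[P]_w (X w * D w)%:E = 0)%E.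
Proof.
move=> GX X0 iXD.
have mX : measurable_fun setT (EFin \o X : g_sigma_algebraType G -> \bar R).
  by apply/measurable_EFinP; exact: sub_measurable_fun_sigma.
pose h n := nnsfun_approx measurableT mX n.
have mh n : measurable_fun setT (h n : Omega -> R).
  by apply: sub_measurable_fun; apply: sigma_sub_measurable_fun.
have [] := @dominated_convergence _ _ _ P setT measurableT
  (fun n w => (h n w * D w)%:E) (fun w => (X w * D w)%:E)
  (fun w => `|(X w * D w)%:E|%E).
- by move=> n; apply/measurable_EFinP/measurable_funM.

- exact: (measurable_int P).
- apply: aeW => w _.
  have /= Xw := @cvg_nnsfun_approx _ _ _ setT measurableT _ mX
    (fun x _ => ltac:(by rewrite lee_fin; exact: X0)) w I.
  under eq_fun do rewrite EFinM.
  rewrite EFinM; apply: cvgeZr => //.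
- exact: integrable_abse.
- apply: aeW => w n _; rewrite !EFinM !abseM lee_pmul// !gee0_abs ?lee_fin//.
  rewrite /h nnsfun_approxE -lee_fin.
  apply: (@le_approx _ _ _ setT (EFin \o X)) => // x _.
  by rewrite lee_fin.
move=> _ _ hXD; rewrite -(cvg_lim _ hXD)//.
under eq_fun do rewrite integral_nnsfunM.
exact: lim_cst.
Qed.

(** Positive and negative parts of [X] are still [G]-measurable and are dominated by [|X|], so their
    products with [D] inherit integrability and the nonnegative case handles each. Integrability is
    asked of the product [X * D], which is what two square-integrable factors provide. *)
Lemma integral_subM (X : Omega -> R) :
  (forall B, measurable B -> G (X @^-1` B)) ->
  P.-integrable setT (fun w => (X w * D w)%:E) ->
  (\int[P]_w (X w * D w)%:E = 0)%E.
Proof.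
move=> GX iXD.
have mX : measurable_fun setT X by exact: sub_measurable_fun.
have mXG : measurable_fun setT (X : g_sigma_algebraType G -> R).
  exact: sub_measurable_fun_sigma.
have ip : P.-integrable setT (fun w => (X^\+%R w * D w)%:E).
  apply: le_integrable iXD => //.
    by apply/measurable_EFinP/measurable_funM => //; exact: measurable_funrpos.
  move=> w _; rewrite lee_fin !normrM ler_wpM2r//.
  by rewrite /funrpos; case: (lerP (X w) 0) => // ?; rewrite normr0.
have im : P.-integrable setT (fun w => (X^\-%R w * D w)%:E).
  apply: le_integrable iXD => //.
    by apply/measurable_EFinP/measurable_funM => //; exact: measurable_funrneg.
  move=> w _; rewrite lee_fin !normrM ler_wpM2r//.
  by rewrite /funrneg; case: (lerP (- X w) 0) => // ?; rewrite ?normr0 ?normrN.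
transitivity (\int[P]_w ((X^\+%R w * D w)%:E - (X^\-%R w * D w)%:E))%E.
  apply: eq_integral => w _; rewrite -EFinB -mulrBl; congr ((_ * _)%:E).
  by by rewrite -{1}(funrposBneg X).
rewrite integralB// !integral_subM_ge0 ?sube0//.
- by apply: sigma_sub_measurable_fun; exact: measurable_funrneg.
- by apply: sigma_sub_measurable_fun; exact: measurable_funrpos.
Qed.

End pull_out.

(** * The Pythagorean identity for one conditional expectation *)

Section orthogonality.
Context {d : measure_display} {Omega : measurableType d} {R : realType}.
Variable P : {measure set Omega -> \bar R}.

Lemma integrable_sqrB (u v : Omega -> R) :
  measurable_fun setT u -> measurable_fun setT v ->
  P.-integrable setT (fun w => (u w ^+ 2)%:E) ->
  P.-integrable setT (fun w => (v w ^+ 2)%:E) ->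
  P.-integrable setT (fun w => ((u w - v w) ^+ 2)%:E).
Proof.
move=> mu mv iu iv.
have : P.-integrable setT (fun w => 2%:E * ((u w ^+ 2)%:E + (v w ^+ 2)%:E))%E.
  by apply: integrableZl => //; exact: integrableD.
apply: le_integrable => //.
  by apply/measurable_EFinP/measurable_funX/measurable_funB.
move=> w _; rewrite -EFinD -EFinM lee_fin !ger0_norm ?sqr_ge0//.
  (* The parallelogram identity: [2 (u^2 + v^2) - (u - v)^2 = (u + v)^2]. *)
  by have := sqr_ge0 (u w + v w); nra.
by rewrite mulr_ge0// addr_ge0// sqr_ge0.
Qed.

Lemma integrable_sqrM (u v : Omega -> R) :
  measurable_fun setT u -> measurable_fun setT v ->
  P.-integrable setT (fun w => (u w ^+ 2)%:E) ->
  P.-integrable setT (fun w => (v w ^+ 2)%:E) ->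
  P.-integrable setT (fun w => (u w * v w)%:E).
Proof.
move=> mu mv iu iv.
have : P.-integrable setT (fun w => (u w ^+ 2)%:E + (v w ^+ 2)%:E)%E.
  exact: integrableD.
apply: le_integrable => //.
  by apply/measurable_EFinP/measurable_funM.
move=> w _; rewrite -EFinD lee_fin [leRHS]ger0_norm; last first.
  by rewrite addr_ge0// sqr_ge0.
have := sqr_ge0 (u w + v w); have := sqr_ge0 (u w - v w).
by rewrite ler_norml => ? ?; apply/andP; split; nra.
Qed.

(** Here [v] is a version of E[u | G], so [D = u - v] integrates to 0 over every set of [G] and is
    therefore orthogonal to the [G]-measurable function [(v - x) * \1_A]. Expanding the square of
    [u - x = (v - x) + D] leaves no cross term. *)
Lemma integral_sqrB_orthogonal (G : set (set Omega)) (u v x : Omega -> R)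
    (A : set Omega) :
  sigma_algebra setT G -> G `<=` measurable ->
  measurable_fun setT u ->
  (forall B, measurable B -> G (v @^-1` B)) ->
  (forall B, measurable B -> G (x @^-1` B)) ->
  P.-integrable setT (EFin \o u) -> P.-integrable setT (EFin \o v) ->
  P.-integrable setT (fun w => (u w ^+ 2)%:E) ->
  P.-integrable setT (fun w => (v w ^+ 2)%:E) ->
  P.-integrable setT (fun w => (x w ^+ 2)%:E) ->
  (forall B, G B ->
    (\int[P]_(w in B) (v w)%:E = \int[P]_(w in B) (u w)%:E)%E) ->
  G A ->
  (\int[P]_(w in A) ((u w - x w) ^+ 2)%:E =
   \int[P]_(w in A) ((v w - x w) ^+ 2)%:E +
   \int[P]_(w in A) ((u w - v w) ^+ 2)%:E)%E.
Proof.
move=> sG Gm mu Gv Gx iu iv iu2 iv2 ix2 uv GA.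
have mA : measurable A by exact: Gm.
have mv : measurable_fun setT v by exact: sub_measurable_fun Gm _ Gv.
have mx : measurable_fun setT x by exact: sub_measurable_fun Gm _ Gx.
pose D w := u w - v w.
have mD : measurable_fun setT D by exact: measurable_funB.
have iD : P.-integrable setT (EFin \o D).
  by rewrite (_ : EFin \o D = (EFin \o u) \- (EFin \o v))%E//;
    exact: integrableB.
have D0 B : G B -> (\int[P]_(w in B) (D w)%:E = 0)%E.
  move=> GB; have mB := Gm _ GB.
  have iuB : P.-integrable B (EFin \o u) by exact: integrableS iu.
  have ivB : P.-integrable B (EFin \o v) by exact: integrableS iv.
  under eq_integral do rewrite /D EFinB.
  rewrite integralB// uv// subee//.
  exact: integrable_fin_num.
have iD2 : P.-integrable setT (fun w => (D w ^+ 2)%:E).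
  exact: integrable_sqrB.
have ivx2 : P.-integrable setT (fun w => ((v w - x w) ^+ 2)%:E).
  exact: integrable_sqrB.
have mvx : measurable_fun setT (v \- x) by exact: measurable_funB.
have ivxD : P.-integrable setT (fun w => ((v w - x w) * D w)%:E).
  exact: integrable_sqrM.
have vxD0 : (\int[P]_(w in A) ((v w - x w) * D w)%:E = 0)%E.
  rewrite integral_mkcond.
  (* The localization to [A] is absorbed into the [G]-measurable factor, which turns the integral
     into one over the whole space. *)
  transitivity (\int[P]_w (((v w - x w) * \1_A w) * D w)%:E)%E.
    apply: eq_integral => w _; rewrite patchE indicE.
    by case: ifPn => _; rewrite ?mulr1// mulr0 mul0r.
  apply: (integral_subM _ _ sG Gm _ mD iD D0).
    apply: sigma_sub_measurable_fun => //.
    apply: measurable_funM.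
      by apply: measurable_funB; exact: sub_measurable_fun_sigma.
    apply: measurable_indic.
    by rewrite measurable_g_measurableTypeE.
  apply: le_integrable ivxD => //.
    apply/measurable_EFinP; apply: measurable_funM => //.
    by apply: measurable_funM => //; exact: measurable_indic.
  move=> w _; rewrite lee_fin !normrM indicE -mulrA ler_wpM2l// ler_piMl//.
  by case: (_ \in _); rewrite ?normr1 ?normr0.
transitivity (\int[P]_(w in A) (((v w - x w) ^+ 2)%:E + (D w ^+ 2)%:E +
    2%:E * ((v w - x w) * D w)%:E))%E.
  apply: eq_integral => w _; rewrite -EFinM -!EFinD; congr (_%:E).
  by rewrite /D; ring.
have iS g : P.-integrable setT g -> P.-integrable A g by exact: integrableS.
rewrite integralD//; last 2 first.
  by apply: integrableD => //; exact: iS.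
  by apply: integrableZl => //; exact: iS.
rewrite integralD//; [|exact: iS|exact: iS].
by rewrite integralZl// ?vxD0 ?mule0 ?adde0//; exact: iS.
Qed.

End orthogonality.

(** * Complex scalars through their real and imaginary parts *)

Lemma normc_sqr (R : realType) (z : R[i]) :
  normc z ^+ 2 = complex.Re z ^+ 2 + complex.Im z ^+ 2.
Proof. by case: z => a b /=; rewrite sqr_sqrtr// addr_ge0// sqr_ge0. Qed.

Lemma ReB (R : realType) (z t : R[i]) :
  complex.Re (z - t) = complex.Re z - complex.Re t.
Proof. by case: z t => [? ?] []. Qed.

Lemma ImB (R : realType) (z t : R[i]) :
  complex.Im (z - t) = complex.Im z - complex.Im t.
Proof. by case: z t => [? ?] []. Qed.

Section complex_functions.
Context {d : measure_display} {Omega : measurableType d} {R : realType}.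
Variable P : {measure set Omega -> \bar R}.

Lemma measurable_normc_sqr (X : Omega -> R[i]) :
  cmeasurable measurable X ->
  measurable_fun setT (fun w => normc (X w) ^+ 2).
Proof.
move=> mX; under eq_fun do rewrite normc_sqr.
by apply: measurable_funD; apply: measurable_funX => _ B mB;
  rewrite setTI; case: (mX B mB).
Qed.

Lemma integral_normc_sqr (X : Omega -> R[i]) (A : set Omega) :
  cmeasurable measurable X -> measurable A ->
  (\int[P]_(w in A) (normc (X w) ^+ 2)%:E =
   \int[P]_(w in A) (complex.Re (X w) ^+ 2)%:E +
   \int[P]_(w in A) (complex.Im (X w) ^+ 2)%:E)%E.
Proof.
move=> mX mA; under eq_integral do rewrite normc_sqr EFinD.
rewrite ge0_integralD//.
- by move=> w _; rewrite lee_fin sqr_ge0.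
- apply/measurable_EFinP/measurable_funX/measurable_funTS => _ B mB.
  by rewrite setTI; case: (mX B mB).
- by move=> w _; rewrite lee_fin sqr_ge0.
- apply/measurable_EFinP/measurable_funX/measurable_funTS => _ B mB.
  by rewrite setTI; case: (mX B mB).
Qed.

Lemma cmeasurableB (G : set (set Omega)) (X Y : Omega -> R[i]) :
  sigma_algebra setT G -> cmeasurable G X -> cmeasurable G Y ->
  cmeasurable G (fun w => X w - Y w).
Proof.
move=> sG mX mY B mB; split.
- rewrite [X in G X](_ : _ =
      (fun w => complex.Re (X w) - complex.Re (Y w)) @^-1` B).
    apply: sigma_sub_measurable_fun => //.
    apply: measurable_funB; apply: sub_measurable_fun_sigma => // C mC.
    + by case: (mX C mC).
    + by case: (mY C mC).
  by apply/seteqP; split => w /=; rewrite ReB.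
- rewrite [X in G X](_ : _ =
      (fun w => complex.Im (X w) - complex.Im (Y w)) @^-1` B).
    apply: sigma_sub_measurable_fun => //.
    apply: measurable_funB; apply: sub_measurable_fun_sigma => // C mC.
    + by case: (mX C mC).
    + by case: (mY C mC).
  by apply/seteqP; split => w /=; rewrite ImB.
Qed.

Lemma cmeasurable_cst (G : set (set Omega)) (c : R[i]) :
  sigma_algebra setT G -> cmeasurable G (fun=> c).
Proof.
move=> sG B mB; split.
- exact: (sigma_sub_measurable_fun _ sG (cst (complex.Re c))
    (measurable_cst _)).
- exact: (sigma_sub_measurable_fun _ sG (cst (complex.Im c))
    (measurable_cst _)).
Qed.

Lemma cmeasurable_sub (G H : set (set Omega)) (X : Omega -> R[i]) :
  G `<=` H -> cmeasurable G X -> cmeasurable H X.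
Proof. by move=> GH mX B mB; case: (mX B mB) => ? ?; split; exact: GH. Qed.

End complex_functions.

(** * Increments of an L^2-bounded martingale *)

Section martingale.
Context {d : measure_display} {Omega : measurableType d} {R : realType}.
Variables (P : probability Omega R) (F : nat -> set (set Omega)).
Variable f : nat -> Omega -> R[i].
Hypotheses (Fincr : increasing_sigma_fields F) (fmart : martingale P F f)
  (fL2 : L2_bounded P f).

Let sF n : sigma_algebra setT (F n). Proof. by case: Fincr. Qed.
Let mF n : F n `<=` measurable. Proof. by case: Fincr => _ /(_ n). Qed.

Lemma increasing_sigma_fields_le m n : (m <= n)%N -> F m `<=` F n.
Proof.
move=> mn; rewrite -(subnKC mn); elim: (n - m)%N => [|k IH].
  by rewrite addn0.
by rewrite addnS; apply: subset_trans IH _; case: Fincr.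
Qed.

Let fF n : cmeasurable (F n) (f n). Proof. by case: fmart => /(_ n). Qed.

Let fm n : cmeasurable measurable (f n).
Proof. exact: cmeasurable_sub (mF n) (fF n). Qed.

(** The bound is [m.+1] because of the shift in [prev]: for positive [n] the function is f_{n-1},
    and for [n = 0] it is constant. *)
Lemma cmeasurable_prev m n : (n <= m.+1)%N -> cmeasurable (F m) (prev f n).
Proof.
case: n => [_|n nm]; first exact: cmeasurable_cst.
apply: (@cmeasurable_sub _ _ _ (F n)) => //.
exact: increasing_sigma_fields_le.
Qed.

Lemma cmeasurable_mdiff k : cmeasurable measurable (mdiff f k).
Proof.
apply: (cmeasurable_sub _ _ _ (mF k)); apply: cmeasurableB => //.
exact: cmeasurable_prev.
Qed.

Lemma L2_bounded_integrable n :
  P.-integrable setT (fun w => (normc (f n w) ^+ 2)%:E).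
Proof.
apply/integrableP; split.
  by apply/measurable_EFinP/measurable_normc_sqr.
under eq_integral do rewrite gee0_abs ?lee_fin ?sqr_ge0//.
by apply: le_lt_trans fL2; apply: ereal_sup_ubound; exists n.
Qed.

Lemma prev_integrable n :
  P.-integrable setT (fun w => (normc (prev f n w) ^+ 2)%:E).
Proof.
case: n => [|n]; last exact: L2_bounded_integrable.
rewrite (_ : (fun _ => _) = cst 0%E); first exact: integrable0.
by apply/funext => w; rewrite normc_sqr /= expr0n addr0.
Qed.

Let integrable_Re_sqr (X : Omega -> R[i]) : cmeasurable measurable X ->
  P.-integrable setT (fun w => (normc (X w) ^+ 2)%:E) ->
  P.-integrable setT (fun w => (complex.Re (X w) ^+ 2)%:E).
Proof.
move=> mX; apply: le_integrable => //.
  apply/measurable_EFinP/measurable_funX => _ B mB.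
  by rewrite setTI; case: (mX B mB).
move=> w _; rewrite lee_fin normc_sqr !ger0_norm ?addr_ge0 ?sqr_ge0//.
by rewrite lerDl sqr_ge0.
Qed.

Let integrable_Im_sqr (X : Omega -> R[i]) : cmeasurable measurable X ->
  P.-integrable setT (fun w => (normc (X w) ^+ 2)%:E) ->
  P.-integrable setT (fun w => (complex.Im (X w) ^+ 2)%:E).
Proof.
move=> mX; apply: le_integrable => //.
  apply/measurable_EFinP/measurable_funX => _ B mB.
  by rewrite setTI; case: (mX B mB).
move=> w _; rewrite lee_fin normc_sqr !ger0_norm ?addr_ge0 ?sqr_ge0//.
by rewrite lerDr sqr_ge0.
Qed.

(** The martingale property compares real-valued integrals, that is, values of [fine]. Integrability
    makes the extended integrals finite, so the equality lifts to them. *)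
Lemma martingale_integral n A : F n A ->
  (\int[P]_(w in A) (complex.Re (f n w))%:E =
   \int[P]_(w in A) (complex.Re (f n.+1 w))%:E)%E /\
  (\int[P]_(w in A) (complex.Im (f n w))%:E =
   \int[P]_(w in A) (complex.Im (f n.+1 w))%:E)%E.
Proof.
case: fmart => _ fi /(_ n) [_ _ fE] FA; have mA := mF _ _ FA.
have iS g : P.-integrable setT g -> (\int[P]_(w in A) g w \is a fin_num)%E.
  by move=> ig; apply: integrable_fin_num => //; exact: integrableS ig.
have [[re im] [re' im']] := (fi n, fi n.+1).
have [hre him] := fE _ FA; split.
- by have := congr1 EFin hre; rewrite !fineK//; exact: iS.
- by have := congr1 EFin him; rewrite !fineK//; exact: iS.
Qed.

(** [integral_sqrB_orthogonal] is applied to the real and to the imaginary parts, with u = f_{m+1},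
    v = f_m and x = X. *)
Lemma martingale_step m (X : Omega -> R[i]) A :
  cmeasurable (F m) X ->
  P.-integrable setT (fun w => (normc (X w) ^+ 2)%:E) ->
  F m A ->
  (\int[P]_(w in A) (normc (f m.+1 w - X w) ^+ 2)%:E =
   \int[P]_(w in A) (normc (f m w - X w) ^+ 2)%:E +
   \int[P]_(w in A) (normc (mdiff f m.+1 w) ^+ 2)%:E)%E.
Proof.
move=> FX iX FA; have mA := mF _ _ FA.
have mX := cmeasurable_sub _ _ _ (mF m) FX.
have E (Y Z : Omega -> R[i]) :
    cmeasurable measurable Y -> cmeasurable measurable Z ->
    (\int[P]_(w in A) (normc (Y w - Z w) ^+ 2)%:E =
     \int[P]_(w in A) ((complex.Re (Y w) - complex.Re (Z w)) ^+ 2)%:E +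
     \int[P]_(w in A) ((complex.Im (Y w) - complex.Im (Z w)) ^+ 2)%:E)%E.
  move=> mY mZ.
  rewrite (integral_normc_sqr P (fun w => Y w - Z w))//; last first.
    by apply: cmeasurableB => //; exact: sigma_algebra_measurable.
  by congr (_ + _)%E; apply: eq_integral => w _; rewrite ?ReB ?ImB.
have [_ fi _] := fmart.
have [re im] := fi m; have [re' im'] := fi m.+1.
have mE := martingale_integral m.
(* The four summands on the right are regrouped so that real parts meet real parts and imaginary
   parts meet imaginary parts. *)
rewrite /mdiff !E//= [RHS]addeACA; congr (_ + _)%E.
- apply: (integral_sqrB_orthogonal P (F m) (fun w => complex.Re (f m.+1 w))
    (fun w => complex.Re (f m w)) (fun w => complex.Re (X w))) => //.
  + by move=> _ B mB; rewrite setTI; case: (fm m.+1 B mB).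
  + by move=> B mB; case: (fF m B mB).
  + by move=> B mB; case: (FX B mB).
  + by apply: integrable_Re_sqr => //; exact: L2_bounded_integrable.
  + by apply: integrable_Re_sqr => //; exact: L2_bounded_integrable.
  + exact: integrable_Re_sqr.
  + by move=> B /mE[].
- apply: (integral_sqrB_orthogonal P (F m) (fun w => complex.Im (f m.+1 w))
    (fun w => complex.Im (f m w)) (fun w => complex.Im (X w))) => //.
  + by move=> _ B mB; rewrite setTI; case: (fm m.+1 B mB).
  + by move=> B mB; case: (fF m B mB).
  + by move=> B mB; case: (FX B mB).
  + by apply: integrable_Im_sqr => //; exact: L2_bounded_integrable.
  + by apply: integrable_Im_sqr => //; exact: L2_bounded_integrable.
  + exact: integrable_Im_sqr.
  + by move=> B /mE[].
Qed.

(** Induction on [m - n], each step peeling off the last increment with [X := prev f n]. The base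
    case is the definition of [mdiff], and [A] stays admissible since it lies in every later
    sigma-field. *)
Lemma martingale_pythagoras n m A : (n <= m)%N -> F n A ->
  (\int[P]_(w in A) (normc (f m w - prev f n w) ^+ 2)%:E =
   \sum_(n <= k < m.+1) \int[P]_(w in A) (normc (mdiff f k w) ^+ 2)%:E)%E.
Proof.
move=> nm FA; rewrite -(subnKC nm); elim: (m - n)%N => [|j IH].
  by rewrite addn0 big_nat1.
rewrite addnS big_nat_recr/=; last by rewrite -addnS leq_addr.
rewrite -IH; apply: martingale_step.
- by apply: cmeasurable_prev; rewrite -addnS leq_addr.
- exact: prev_integrable.
- by apply: increasing_sigma_fields_le FA; exact: leq_addr.
Qed.

Variable N : nat.
Hypothesis ffin : finite_at P f N.

Let ae_final k : {ae P, forall w, f (N + k)%N w = f N w}.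
Proof.
elim: k => [|k IH]; first by apply: aeW => w; rewrite addn0.
have : {ae P, forall w, mdiff f (N + k).+1 w = 0}.
  by apply: ffin; rewrite ltnS leq_addr.
move: IH; apply: filterS2 => w <- /eqP.
by rewrite addnS subr_eq0 => /eqP.
Qed.

Let integral_normc_sqr_ae0 (X : Omega -> R[i]) A :
  measurable A -> cmeasurable measurable X -> {ae P, forall w, X w = 0} ->
  (\int[P]_(w in A) (normc (X w) ^+ 2)%:E = 0)%E.
Proof.
move=> mA mX X0.
rewrite (@ge0_ae_eq_integral _ _ _ P A _ (cst 0%E))//; first exact: integral0.
- by apply/measurable_EFinP/measurable_funTS/measurable_normc_sqr.
- by move=> w _; rewrite lee_fin sqr_ge0.
- move: X0; apply: filterS => w -> _.
  by rewrite normc_sqr /= expr0n addr0.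
Qed.

Lemma integral_mdiff_gt k A : (N < k)%N -> measurable A ->
  (\int[P]_(w in A) (normc (mdiff f k w) ^+ 2)%:E = 0)%E.
Proof.
move=> Nk mA; apply: integral_normc_sqr_ae0 => //; last exact: ffin.
exact: cmeasurable_mdiff.
Qed.

(** For [n <= N] this is the Pythagorean sum up to [N]. For [n > N] the sum is empty, and the left
    side vanishes because f_{n-1} = f_N almost everywhere. *)
Lemma integral_final_prev n A : F n A ->
  (\int[P]_(w in A) (normc (f N w - prev f n w) ^+ 2)%:E =
   \sum_(n <= k < N.+1) \int[P]_(w in A) (normc (mdiff f k w) ^+ 2)%:E)%E.
Proof.
move=> FA; have [nN|] := leqP n N; first exact: martingale_pythagoras.
case: n FA => // n FA; rewrite ltnS => Nn.
rewrite big_geq//; apply: (integral_normc_sqr_ae0 (fun w => f N w - f n w)).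
- exact: mF FA.
- by apply: cmeasurableB => //; exact: sigma_algebra_measurable.
- have := ae_final (n - N); rewrite subnKC//.
  by apply: filterS => w ->; rewrite subrr.
Qed.

End martingale.

(* The library registers [counting] only as a sigma-finite content, whereas
   Tonelli's theorem asks for a sigma-finite measure. *)
HB.instance Definition _ (R : realType) :=
  Measure_isSigmaFinite.Build _ _ _ (@counting nat R) (sigma_finite_counting R).

(** * Integration against the product of [P] with counting measure *)

Section product_counting.
Context {d : measure_display} {Omega : measurableType d}.

(** A preimage is the countable union of its sections at [k], each multiplied by the measurable
    singleton of [k]. *)
Lemma measurable_fun_prod_nat d' (T : measurableType d')
    (h : Omega * nat -> T) :
  (forall k, measurable_fun setT (fun w => h (w, k))) -> measurable_fun setT h.
Proof.
move=> mh _ B mB; rewrite setTI.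
rewrite (_ : h @^-1` B = \bigcup_k (((fun w => h (w, k)) @^-1` B) `*` [set k])).
  apply: bigcup_measurable => k _; apply: measurableX => //.
  by rewrite -[X in measurable X]setTI; exact: mh.
apply/seteqP; split => [[w k] Bwk|[w k] [j _ [/= Bwj ->]]//].
by exists k.
Qed.

(** Tonelli with [Omega] as the inner variable; the outer integral against counting measure is a
    series. Joint measurability of [h] restricted to [E] comes from its sections. *)
Lemma ge0_integral_prod_counting (R : realType) (P : probability Omega R)
    (h : Omega * nat -> \bar R) (E : set (Omega * nat)) :
  (forall k, measurable_fun setT (fun w => h (w, k))) ->
  (forall z, 0 <= h z)%E ->
  (forall k, measurable [set w | E (w, k)]) ->
  (\int[P \x @counting nat R]_(z in E) h z =
   \sum_(0 <= k <oo) \int[P]_(w in [set w | E (w, k)]) h (w, k))%E.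
Proof.
move=> mh h0 mE; rewrite integral_mkcond fubini_tonelli2.
- rewrite ge0_integral_count.
    apply: eq_eseriesr => k _; rewrite [RHS]integral_mkcond /fubini_G.
    apply: eq_integral => w _; rewrite !patchE.
    by congr (if _ then _ else _); apply/idP/idP; rewrite !inE.
  by move=> k; apply: integral_ge0 => w _; exact: erestrict_ge0.
- apply: measurable_fun_prod_nat => k.
  rewrite [X in measurable_fun _ X](_ : _ =
      (fun w => h (w, k)) \_ [set w | E (w, k)]).
    by apply/(measurable_restrictT _ _).1 => //; exact: measurable_funTS.
  apply/funext => w; rewrite !patchE.
  by congr (if _ then _ else _); apply/idP/idP; rewrite !inE.
- by move=> z; exact: erestrict_ge0.
Qed.

End product_counting.

(** * Stopping times and the measure of their tents *)

Section stopping_times.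
Context {d : measure_display} {Omega : measurableType d} {R : realType}.
Variables (P : probability Omega R) (F : nat -> set (set Omega)).
Hypothesis Fincr : increasing_sigma_fields F.

Let sF n : sigma_algebra setT (F n). Proof. by case: Fincr. Qed.
Let mF n : F n `<=` measurable. Proof. by case: Fincr => _ /(_ n). Qed.

Lemma sigma_field_setD n A B : F n A -> F n B -> F n (A `\` B).
Proof.
move=> FA FB; rewrite -(measurable_g_measurableTypeE (sF n)).
by apply: measurableD; rewrite measurable_g_measurableTypeE.
Qed.

(** The event that [stopping_time] places in [F n] is also the section of [tent tau] at level
    [n]. *)
Definition stopped_by (tau : Omega -> option nat) (n : nat) : set Omega :=
  [set w | exists2 t, tau w = Some t & (t <= n)%N].

Lemma stopped_byS tau n :
  stopped_by tau n.+1 = stopped_by tau n `|` [set w | tau w = Some n.+1].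
Proof.
apply/seteqP; split => w.
  case=> t tw; rewrite leq_eqVlt => /orP[/eqP tn|tn].
    by right; rewrite /= tw tn.
  by left; exists t.
by case=> [[t tw tn]|tw]; [exists t => //; exact: leqW|exists n.+1].
Qed.

Lemma stopping_time_at tau n : stopping_time F tau ->
  F n [set w | tau w = Some n].
Proof.
move=> Ftau; case: n => [|n].
  rewrite (_ : [set _ | _] = stopped_by tau 0%N); first exact: Ftau.
  apply/seteqP; split => w /=; first by exists 0%N.
  by case=> t ->; rewrite leqn0 => /eqP ->.
rewrite (_ : [set _ | _] = stopped_by tau n.+1 `\` stopped_by tau n).
  apply: sigma_field_setD; first exact: Ftau.
  by apply: (increasing_sigma_fields_le _ Fincr n) => //; exact: Ftau.
rewrite stopped_byS setDUl setDv set0U; apply/esym/setDidl/seteqP.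
by split => // w [/= tw [t]]; rewrite tw => -[<-]; rewrite ltnn.
Qed.

Lemma event_finiteE (tau : Omega -> option nat) :
  event_finite tau = \bigcup_n [set w | tau w = Some n].
Proof.
apply/seteqP; split => w; rewrite /event_finite /=.
  by case E : (tau w) => [n|//] _; exists n.
by case=> n _ /= ->.
Qed.

Lemma trivIset_stopping (tau : Omega -> option nat) :
  trivIset setT (fun n => [set w | tau w = Some n]).
Proof. by move=> m n _ _ [w /= [->]] []. Qed.

(** The events {tau = k} are disjoint with union {tau < oo}, so a partial sum is at most the full
    series. This is what allows bounds on the slices to be added up. *)
Lemma sum_stopping_le tau n : stopping_time F tau ->
  (\sum_(0 <= k < n) P [set w | tau w = Some k] <= P (event_finite tau))%E.
Proof.
move=> Ftau.
have mt k : measurable [set w | tau w = Some k].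
  exact: mF (stopping_time_at _ k Ftau).
rewrite event_finiteE measure_bigcup//=; last exact: trivIset_stopping.
rewrite [leLHS](eq_bigl (fun k => k \in [set: nat])); last first.
  by move=> k; rewrite in_setT.
exact: nneseries_lim_ge.
Qed.

Lemma integral_stopped_by tau (h : Omega -> \bar R) n : stopping_time F tau ->
  measurable_fun setT h -> (forall w, 0 <= h w)%E ->
  (\int[P]_(w in stopped_by tau n) h w =
   \sum_(0 <= k < n.+1) \int[P]_(w in [set w | tau w = Some k]) h w)%E.
Proof.
move=> Ftau mh h0.
have mt k : measurable [set w | tau w = Some k].
  exact: mF (stopping_time_at _ k Ftau).
elim: n => [|n IH].
  rewrite big_nat1; congr (integral _ _ _).
  apply/seteqP; split => w /=; last by exists 0%N.
  by case=> t ->; rewrite leqn0 => /eqP ->.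
rewrite stopped_byS ge0_integral_setU//.
- by rewrite IH [RHS]big_nat_recr.
- exact: mF (Ftau n).
- exact: measurable_funTS.
- apply/disj_setPS => w [[t tw tn] /= tw'].
  by move: tw tn; rewrite tw' => -[<-]; rewrite ltnn.
Qed.

Variable f : nat -> Omega -> R[i].
Hypotheses (fmart : martingale P F f).
Variable N : nat.
Hypothesis ffin : finite_at P f N.

(** Tonelli gives a series over the levels [k], whose terms beyond [N] vanish since the martingale
    has stopped. *)
Lemma square_diff_measure_tent tau : stopping_time F tau ->
  (square_diff_measure P f (tent tau) =
   \sum_(0 <= k < N.+1)
     \int[P]_(w in stopped_by tau k) (normc (mdiff f k w) ^+ 2)%:E)%E.
Proof.
move=> Ftau; rewrite /square_diff_measure ge0_integral_prod_counting.
- rewrite (@nneseries_split _ _ 0 N.+1); last first.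
    by move=> k _; apply: integral_ge0 => w _; rewrite lee_fin sqr_ge0.
  rewrite add0n [X in (_ + X)%E]eseries0 ?adde0//= => k Nk _.
  apply: (integral_mdiff_gt _ _ _ Fincr fmart _ ffin) => //.
  exact: mF (Ftau k).
- move=> k /=; apply/measurable_EFinP/measurable_normc_sqr.
  exact: (cmeasurable_mdiff P F).
- by move=> z; rewrite lee_fin sqr_ge0.
- by move=> k; exact: mF (Ftau k).
Qed.

Hypothesis fL2 : L2_bounded P f.

Lemma square_diff_measure_tentE tau : stopping_time F tau ->
  (square_diff_measure P f (tent tau) =
   \sum_(0 <= n < N.+1) \int[P]_(w in [set w | tau w = Some n])
     (normc (f N w - prev f n w) ^+ 2)%:E)%E.
Proof.
move=> Ftau; rewrite square_diff_measure_tent//.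
pose a n k := (\int[P]_(w in [set w | tau w = Some n])
  (normc (mdiff f k w) ^+ 2)%:E)%E.
(* Each level is cut into the events {tau = n} with [n <= k]. After the sums are exchanged, the
   inner one runs over [n <= k <= N], which is the sum in [integral_final_prev]. *)
transitivity (\sum_(0 <= k < N.+1) \sum_(0 <= n < N.+1 | (n < k.+1)%N) a n k)%E.
  apply: eq_big_nat => k /andP[_ kN]; rewrite integral_stopped_by//.
  - by rewrite (big_nat_widen 0 _ N.+1).
  - apply/measurable_EFinP/measurable_normc_sqr.
    exact: (cmeasurable_mdiff P F).
  - by move=> w; rewrite lee_fin sqr_ge0.
rewrite (exchange_big_dep_nat predT)//=.
apply: eq_bigr => n _.
rewrite (integral_final_prev P F f Fincr fmart fL2 _ ffin)//; last first.
  exact: stopping_time_at.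
by rewrite [RHS](big_nat_widenl _ 0%N).
Qed.

(** The tent has section [A] at each level [k >= n] and an empty section below, so its measure is
    the Pythagorean sum over [A] starting at [n]. *)
Lemma square_diff_measure_tent_const n A : F n A ->
  let tau w := if w \in A then Some n else None in
  [/\ stopping_time F tau, event_finite tau = A &
    (square_diff_measure P f (tent tau) =
     \int[P]_(w in A) (normc (f N w - prev f n w) ^+ 2)%:E)%E].
Proof.
move=> FA tau.
have sE k : stopped_by tau k = if (n <= k)%N then A else set0.
  apply/seteqP; split => w.
    case=> t; rewrite /tau; case: ifPn => // /set_mem Aw [<-] ->//.
  by case: ifPn => // nk Aw; exists n; rewrite ?/tau ?mem_set.
have Ftau : stopping_time F tau.
  move=> k; rewrite -/(stopped_by tau k) sE; case: ifPn => [nk|_].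
    exact: increasing_sigma_fields_le FA.
  by case: (sF k).
split => //.
  apply/seteqP; split => w; rewrite /event_finite /tau /=.
    by case: ifPn => // /set_mem.
  by move/mem_set ->.
rewrite square_diff_measure_tent//.
rewrite (integral_final_prev P F f Fincr fmart fL2 _ ffin)//.
rewrite [RHS](big_nat_widenl _ 0%N)// [RHS]big_mkcond/=.
apply: eq_bigr => k _; rewrite sE; case: ifPn => // _.
by rewrite integral_set0.
Qed.

End stopping_times.

(** * Finite suprema rewritten as inequalities with a constant *)

Section bounds.
Context {R : realType}.

Lemma lty_nonneg_bound (x : \bar R) : (x < +oo)%E ->
  exists2 c : R, 0 <= c & (x <= c%:E)%E.
Proof.
case: x => [r _||_]; [|by rewrite ltxx|by exists 0; rewrite ?leNye].
by exists (Num.max r 0); rewrite ?lee_fin le_max lexx ?orbT.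
Qed.

(** Clear the power of [p] and square: twice the exponent 1/2 + alpha is 1 + 2 alpha. For [x = +oo]
    both inequalities fail. *)
Lemma le_powR_sqrt (p c alpha : R) (x : \bar R) :
  0 < p -> 0 <= c -> (0 <= x)%E ->
  (p%:E `^ (- 2^-1 - alpha) * x `^ 2^-1 <= c%:E)%E =
  (x <= (c ^+ 2 * p `^ (1 + 2 * alpha))%:E)%E.
Proof.
move=> p0 c0; case: x => [r|_|//].
  rewrite lee_fin => r0.
  have pa : 0 < p `^ (2^-1 + alpha) by exact: powR_gt0.
  rewrite -opprD !poweR_EFin -EFinM !lee_fin powRN mulrC ler_pdivrMr//.
  have cp0 : 0 <= c * p `^ (2^-1 + alpha) by rewrite mulr_ge0// ltW.
  rewrite powR12_sqrt// -[LHS]ler_sqr ?nnegrE ?sqrtr_ge0//.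
  rewrite sqr_sqrtr// exprMn; congr (_ <= _ * _).
  by rewrite -powR_mulrn ?powR_ge0// -powRrM; congr (_ `^ _); field.
by rewrite poweRyr ?invr_neq0// poweR_EFin gt0_muley ?lte_fin ?powR_gt0//.
Qed.

End bounds.

Section characterizations.
Context {d : measure_display} {Omega : measurableType d} {R : realType}.
Variables (P : probability Omega R) (F : nat -> set (set Omega)) (alpha : R).

(** The constant [C] bounds the square of the norm: a norm bound [c] gives [c ^+ 2], and conversely
    [C] gives the norm bound [Num.sqrt C]. *)
Lemma in_BMOP (f : nat -> Omega -> R[i]) (g : Omega -> R[i]) :
  (forall n, F n `<=` measurable) ->
  in_BMO P F alpha f g <-> exists2 C : R, 0 <= C &
    forall n A, F n A -> (0 < P A)%E ->
      (\int[P]_(w in A) (normc (g w - prev f n w) ^+ 2)%:E <=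
       (C * fine (P A) `^ (1 + 2 * alpha))%:E)%E.
Proof.
move=> Fm.
have I0 n A : (0 <= \int[P]_(w in A) (normc (g w - prev f n w) ^+ 2)%:E)%E.
  by apply: integral_ge0 => w _; rewrite lee_fin sqr_ge0.
have PE n A : F n A -> (P A = (fine (P A))%:E)%E.
  by move=> FA; rewrite fineK// fin_num_measure//; exact: Fm FA.
split.
  move=> /lty_nonneg_bound[c c0 fc]; exists (c ^+ 2) => [|n A FA PA].
    exact: sqr_ge0.
  have p0 : 0 < fine (P A) by rewrite -lte_fin -(PE n).
  rewrite -le_powR_sqrt// -(PE n)//; apply: le_trans fc.
  apply: le_trans (ereal_sup_ubound _); last by exists n.
  by apply: ereal_sup_ubound; exists A.
move=> [C C0 fC]; apply: (@le_lt_trans _ _ (Num.sqrt C)%:E); last exact: ltry.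
apply: ge_ereal_sup => _ [n _ <-]; apply: ge_ereal_sup => _ [A [FA PA] <-].
have p0 : 0 < fine (P A) by rewrite -lte_fin -(PE n).
rewrite (PE n)// le_powR_sqrt ?sqrtr_ge0// sqr_sqrtr//.
exact: fC.
Qed.

(** Measurability makes P(tau < oo) a finite number, and its positivity allows the denominator to be
    cleared. *)
Lemma bounded_CarlesonP (mu : set (Omega * nat) -> \bar R) :
  (forall tau, stopping_time F tau -> measurable (event_finite tau)) ->
  bounded_Carleson P F alpha mu <-> exists2 C : R, 0 <= C &
    forall tau, stopping_time F tau -> (0 < P (event_finite tau))%E ->
      (mu (tent tau) <=
        (C * fine (P (event_finite tau)) `^ (1 + 2 * alpha))%:E)%E.
Proof.
move=> mtau.
have quotE tau c : stopping_time F tau -> (0 < P (event_finite tau))%E ->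
    (mu (tent tau) / (P (event_finite tau) `^ (1 + 2 * alpha)) <= c%:E)%E =
    (mu (tent tau) <=
      (c * fine (P (event_finite tau)) `^ (1 + 2 * alpha))%:E)%E.
  move=> Ftau P0.
  have PE : P (event_finite tau) = (fine (P (event_finite tau)))%:E.
    by rewrite fineK// fin_num_measure//; exact: mtau.
  have p0 : 0 < fine (P (event_finite tau)) by rewrite -lte_fin -PE.
  by rewrite {1}PE poweR_EFin inver gt_eqF ?powR_gt0// lee_pdivrMr ?powR_gt0//.
split.
  move=> /lty_nonneg_bound[C C0 muC]; exists C => // tau Ftau P0.
  rewrite -quotE//; apply: le_trans muC.
  by apply: ereal_sup_ubound; exists tau.
move=> [C C0 muC]; apply: (@le_lt_trans _ _ C%:E); last exact: ltry.
by apply: ge_ereal_sup => _ [tau [Ftau P0] <-]; rewrite quotE//; exact: muC.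
Qed.

End characterizations.

(** * Equivalence of the BMO and Carleson bounds *)

Theorem theorem1p4 (d : measure_display) (Omega : measurableType d)
    (R : realType) (P : probability Omega R)
    (Pcomplete : measure_is_complete P)
    (F : nat -> set (set Omega))
    (Fincr : increasing_sigma_fields F)
    (Fgen : <<s \bigcup_n F n >> = @measurable d Omega)
    (alpha : R) (alpha_ge0 : 0 <= alpha) (alpha_lt1 : alpha < 1)
    (f : nat -> Omega -> R[i])
    (fmart : martingale P F f)
    (fL2 : L2_bounded P f)
    (N : nat) (ffin : finite_at P f N) :
  in_BMO P F alpha f (f N) <->
  bounded_Carleson P F alpha (square_diff_measure P f).
Proof.
have Fm n : F n `<=` measurable by case: Fincr => _ /(_ n).
have mt tau n : stopping_time F tau -> measurable [set w | tau w = Some n].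
  by move=> Ftau; apply: (Fm n); exact: stopping_time_at.
have mE tau : stopping_time F tau -> measurable (event_finite tau).
  move=> Ftau; rewrite event_finiteE.
  by apply: bigcup_measurable => n _; exact: mt.
(* In this form both bounds have the exponent 1 + 2 alpha, and the same [C] serves in both
   directions. *)
rewrite in_BMOP// bounded_CarlesonP//; split=> -[C C0 fC]; exists C => //.
- move=> tau Ftau P0.
  set p := fine (P (event_finite tau)).
  have PE : P (event_finite tau) = p%:E.
    by rewrite fineK// fin_num_measure//; exact: mE.
  have p0 : 0 < p by rewrite -lte_fin -PE.
  have a1 : 0 < 1 + 2 * alpha by rewrite ltr_wpDr// mulr_ge0.
  rewrite (square_diff_measure_tentE P F Fincr f fmart N ffin fL2)//.
  (* One factor P(tau < oo) is split off to be shared among the slices; the rest is a common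
     constant. *)
  have CE : (C * p `^ (1 + 2 * alpha))%:E =
      ((C * p `^ (2 * alpha))%:E * P (event_finite tau))%E.
    rewrite PE -EFinM powRD; last by rewrite gt_eqF.
    by rewrite powRr1 1?ltW// -mulrA [p * _]mulrC.
  rewrite CE; apply: (@le_trans _ _ (\sum_(0 <= n < N.+1)
    (C * p `^ (2 * alpha))%:E * P [set w | tau w = Some n])%E); last first.
    rewrite -ge0_sume_distrr//.
    rewrite lee_wpmul2l ?lee_fin ?mulr_ge0 ?powR_ge0//.
    exact: (sum_stopping_le P F).
  apply: lee_sum => n _.
  have mtn := mt tau n Ftau.
  (* The BMO bound speaks only of sets of positive probability, so null slices are treated apart. *)
  have [Pn0|Pn0] := eqVneq (P [set w | tau w = Some n]) 0%E.
    rewrite Pn0 mule0 null_set_integral//.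
    apply/measurable_EFinP/measurable_funTS.
    apply: (measurable_normc_sqr (fun w => f N w - prev f n w)).
    apply: cmeasurableB; first exact: sigma_algebra_measurable.
      by case: fmart => /(_ N) /(cmeasurable_sub _ _ _ (Fm N)).
    exact: cmeasurable_sub (Fm n)
      (cmeasurable_prev _ _ _ Fincr fmart _ _ (leqnSn n)).
  set q := fine (P [set w | tau w = Some n]).
  have QE : P [set w | tau w = Some n] = q%:E.
    by rewrite fineK// fin_num_measure.
  have q0 : 0 < q by rewrite -lte_fin -QE lt0e Pn0 measure_ge0.
  have qp : q <= p.
    rewrite -lee_fin -PE -QE le_measure ?inE//; first exact: mE.
    by rewrite event_finiteE; exact: (bigcup_sup (i := n)).
  apply: (le_trans (fC n _ (stopping_time_at _ _ _ _ Ftau) _)) => //.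
    by rewrite lt0e Pn0 measure_ge0.
  rewrite -/q QE -EFinM lee_fin -mulrA ler_wpM2l//.
  rewrite powRD; last by rewrite gt_eqF.
  have q0W := ltW q0; rewrite powRr1// [leLHS]mulrC ler_wpM2r//.
  (* Since [alpha] is nonnegative, [q <= p] gives the same order for the powers with exponent 2
     alpha. *)
  by apply: ge0_ler_powR; rewrite ?nnegrE ?mulr_ge0// ltW.
- move=> n A FA PA.
  have [Ftau tauA muA] :=
    square_diff_measure_tent_const P F Fincr f fmart N ffin fL2 n A FA.
  by rewrite -muA -{2}tauA; apply: fC => //; rewrite tauA.
Qed.
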